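(* Let $D\in\mathbb{C}^{n\times n}$ be a unitary diagonal matrix and $U\in\mathbb{C}^{n\times k}$ with $n=\ell k$ for some integer $\ell\ge 2$. Then there exist a unitary matrix $P\in\mathbb{C}^{n\times n}$ and a matrix $U_1\in\mathbb{C}^{k\times k}$ such that $PDP^H$ is CMV structured with block size $k$ and $$PU=(e_1\otimes I_k)\,U_1 .$$
   Context: $X^H$ is the conjugate transpose, $e_1$ is the first unit vector of $\mathbb{C}^\ell$, so $e_1\otimes I_k\in\mathbb{C}^{n\times k}$ consists of the first $k$ columns of $I_n$. A block unitary transformation with block size $k$ at position $j$ ($1\le j\le \ell-1$) is an $n\times n$ matrix $\mathcal A_j=I_{(j-1)k}\oplus\hat A_j\oplus I_{(\ell-1-j)k}$ with $\hat A_j$ a $2k\times 2k$ unitary matrix, called the active block of $\mathcal A_j$. Here a unitary matrix $A\in\mathbb{C}^{n\times n}$, $n=\ell k$, is called CMV structured with block size $k$ if it can be factored as $$A=\begin{cases}\mathcal A_1\mathcal A_3\cdots\mathcal A_{\ell-1}\,\mathcal A_2\mathcal A_4\cdots\mathcal A_{\ell-2}&\ell\text{ even},\\ \mathcal A_1\mathcal A_3\cdots\mathcal A_{\ell-2}\,\mathcal A_2\mathcal A_4\cdots\mathcal A_{\ell-1}&\ell\text{ odd},\end{cases}$$ with $\mathcal A_j$ block unitary transformations at position $j$ with block size $k$, whose active blocks have the form $\begin{bmatrix}\times&L\\ R&\times\end{bmatrix}$ with $k\times k$ blocks, $R$ upper triangular and $L$ lower triangular (no invertibility of $R,L$ is required).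 Empty products are the identity. *)

(* Defs.v *)
From mathcomp Require Import all_boot all_order all_algebra.
From mathcomp Require Import complex mxtens reals.
From mathcomp Require Import zify.

Set Implicit Arguments.
Unset Strict Implicit.
Unset Printing Implicit Defensive.

Import Order.TTheory GRing.Theory Num.Theory.

Local Open Scope ring_scope.
Local Open Scope sesquilinear_scope.

Lemma block_unitary_dim (l k j : nat) : (0 < j < l)%N ->
  ((j - 1) * k + (k + k + (l - 1 - j) * k) = l * k)%N.
Proof.
move=> hj; rewrite addnn -mul2n -!mulnDl; congr (_ * k)%N; lia.
Qed.

Section CMV.

Variable C : numClosedFieldType.

(* Positions are numbered from 1, as in I_((j-1)k) (+) Ah (+) I_((l-1-j)k). *)
Definition block_unitary (l k j : nat) (hj : (0 < j < l)%N)
    (Ah : 'M[C]_(k + k)) : 'M[C]_(l * k) :=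
  castmx (block_unitary_dim k hj, block_unitary_dim k hj)
    (block_mx 1%:M 0 0 (block_mx Ah 0 0 1%:M)).

(* is_trig_mx means lower triangular. *)
Definition cmv_active (k : nat) (Ah : 'M[C]_(k + k)) : bool :=
  [&& Ah \is unitarymx, is_trig_mx (ursubmx Ah) & is_trig_mx (dlsubmx Ah)^T].

(* With the positions 1 <= j < l split by parity, both cases (l even, l odd)
   of the factorization take the same form. *)
Definition cmv_structured (l k : nat) (A : 'M[C]_(l * k)) : Prop :=
  A \is unitarymx /\
  exists F : nat -> 'M[C]_(l * k),
    (forall (j : nat) (hj : (0 < j < l)%N),
       exists2 Ah : 'M[C]_(k + k), cmv_active Ah & F j = block_unitary hj Ah) /\
    A = (\prod_(1 <= j < l | odd j) F j) *m (\prod_(1 <= j < l | ~~ odd j) F j).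

Definition e1_tens_id (l k : nat) : 'M[C]_(l * k, k) :=
  castmx (erefl, mul1n k)
    ((\col_(i < l) (i == 0 :> nat)%:R) *t (1%:M : 'M[C]_k)).

Lemma e1_tens_idE (l k : nat) : e1_tens_id l k = pid_mx k.
Proof.
apply/matrixP => i j; rewrite castmxE !mxE /= -natrM mulnb -[_ == Ordinal _]val_eqE /=.
congr ((nat_of_bool _)%:R).
have k_gt0 : (0 < k)%N by case: k j {i} => [[]|].
rewrite (modn_small (ltn_ord j)) andbC.
have [ltik|leki] := ltnP i k.
  by rewrite divn_small // modn_small // andbT.
by rewrite -leqn0 leqNgt divn_gt0 // leki !andbF.
Qed.

End CMV.

Arguments e1_tens_id : clear implicits.

(* Main.v *)
(* Only the unitarity of D matters. A first unitary change of basis moves the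
   column space of U into the first k coordinates. In such a basis, making the
   first block column of A vanish below its second block gives
   A = A_1 (I_k (+) B), where A_1 acts on the first two blocks and B is unitary;
   recursion on B^* then produces all the factors, but with full corner blocks.
   What is left is the choice of an orthonormal basis of each k-dimensional
   block, and independently of each block of the space between the odd and the
   even product, the two choices being the same at the first and at the last
   block. The corner blocks to be triangularized then form two chains of k x k
   matrices, the R_j and the L_j^*, from the first block to the last. The two
   composites are made upper triangular simultaneously by a generalized Schur
   decomposition, and the flags found at both ends are interpolated along each
   chain. *)

Require Import Defs.
From mathcomp Require Import all_boot all_order all_algebra.
From mathcomp Require Import complex mxtens reals.
From mathcomp Require Import zify.

Set Implicit Arguments.
Unset Strict Implicit.
Unset Printing Implicit Defensive.

Import Order.TTheory GRing.Theory Num.Theory.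

Local Open Scope ring_scope.
Local Open Scope sesquilinear_scope.

(** * Unitary reductions and triangular forms *)

Section Triangularization.

Variable C : numClosedFieldType.

Lemma trmxC_mul m n p (A : 'M[C]_(m, n)) (B : 'M_(n, p)) :
  (A *m B)^t* = B^t* *m A^t*.
Proof. by rewrite trmx_mul map_mxM. Qed.

Lemma trmxC1 n : (1%:M : 'M[C]_n)^t* = 1%:M.
Proof. by rewrite trmx1 map_mx1. Qed.

Lemma trmxC0 m n : (0 : 'M[C]_(m, n))^t* = 0.
Proof. by rewrite trmx0 map_mx0. Qed.

Lemma trmxC_block m1 m2 n1 n2 (A : 'M[C]_(m1, n1)) (B : 'M_(m1, n2))
    (A' : 'M_(m2, n1)) (B' : 'M_(m2, n2)) :
  (block_mx A B A' B')^t* = block_mx (A^t*) (A'^t*) (B^t*) (B'^t*).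
Proof. by rewrite tr_block_mx map_block_mx. Qed.

Lemma trmxC_tr m n (A : 'M[C]_(m, n)) : is_trig_mx (A^t*)^T = is_trig_mx A.
Proof.
apply/is_trig_mxP/is_trig_mxP => h i j /h; rewrite !mxE; last by move->; rewrite conjC0.
by move/eqP; rewrite conjC_eq0 => /eqP.
Qed.

Lemma trmxC_trig m n (A : 'M[C]_(m, n)) : is_trig_mx (A^t*) = is_trig_mx A^T.
Proof. by rewrite -[RHS]trmxC_tr -map_trmx trmxK. Qed.

Lemma unitarymx1 n : (1%:M : 'M[C]_n) \is unitarymx.
Proof. by apply/unitarymxP; rewrite trmxC1 mulmx1. Qed.

Lemma mulmxtV n (A : 'M[C]_n) : A \is unitarymx -> A *m A^t* = 1%:M.
Proof. exact/unitarymxP. Qed.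

Lemma mulmxVt n (A : 'M[C]_n) : A \is unitarymx -> A^t* *m A = 1%:M.
Proof. by move=> /mulmxtV/mulmx1C. Qed.

Lemma unitarymx_block_diag m n (A : 'M[C]_m) (B : 'M_n) :
  (block_mx A 0 0 B \is unitarymx) = (A \is unitarymx) && (B \is unitarymx).
Proof.
rewrite !qualifE /= trmxC_block !trmxC0 mulmx_block !mulmx0 !mul0mx !add0r addr0.
rewrite (scalar_mx_block m n); apply/eqP/andP => [/eq_block_mx[-> _ _ ->] //|].
by case=> /eqP-> /eqP->.
Qed.

Lemma mulmx_schmidt_trig n (A : 'M[C]_n) : is_trig_mx (A *m (schmidt A)^t*).
Proof.
apply/is_trig_mxP => i j ltij.
have /unitarymxP AU : schmidt A \is unitarymx by rewrite schmidt_unitarymx.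
have -> : (A *m (schmidt A)^t*) i j = (row i A *m (row j (schmidt A))^t*) 0 0.
  by rewrite !mxE; apply: eq_bigr => h _; rewrite !mxE.
(* Row i of [A] is a combination of the rows h <= i of [schmidt A], all orthogonal to its row j. *)
have /sub_sumsmxP[u ->] := row_schmidt_sub A i.
rewrite mulmx_suml summxE big1 // => h lehi.
have /submxP[v ->] : (u h *m <<row h (schmidt A)>> <= row h (schmidt A))%MS.
  by rewrite (submx_trans (submxMl _ _)) ?genmxE.
rewrite -mulmxA; have /matrixP/(_ h j) := AU; rewrite [1%:M _ _]mxE -val_eqE /=.
rewrite ltn_eqF ?(leq_ltn_trans lehi) // => hj.
suff -> : row h (schmidt A) *m (row j (schmidt A))^t* = 0 by rewrite mulmx0 mxE.
apply/matrixP => a b; rewrite [RHS]mxE; apply: etrans hj; rewrite !mxE.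
by apply: eq_bigr => c _; rewrite !mxE.
Qed.

(** Gram-Schmidt on [V] padded with zero rows gives a lower triangular product, whose first p rows
    vanish beyond column p. *)
Lemma unitary_reduce_row p q (V : 'M[C]_(p, p + q)) :
  exists2 H : 'M_(p + q), H \is unitarymx & rsubmx (V *m H^t*) = 0.
Proof.
exists (schmidt (col_mx V 0)); first by rewrite schmidt_unitarymx.
have := mulmx_schmidt_trig (col_mx V (0 : 'M_(q, p + q))).
by move=> /(ursubmx_trig (leqnn p)); rewrite mul_col_mx /ursubmx col_mxKu.
Qed.

Lemma unitary_reduce_col p q (Y : 'M[C]_(p + q, p)) :
  exists2 H : 'M_(p + q), H \is unitarymx & dsubmx (H *m Y) = 0.
Proof.
have [H HU e] := unitary_reduce_row (Y^t*); exists H => //.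
rewrite -[H *m Y]trmxCK trmxC_mul -[_ *m _]hsubmxK e tr_row_mx map_col_mx.
by rewrite col_mxKd trmxC0.
Qed.

(** Reduction gives V = [L 0] H with L unitary, and (L (+) I) H then extends V. *)
Lemma unitary_complete_row p q (V : 'M[C]_(p, p + q)) : V \is unitarymx ->
  exists2 H : 'M_(p + q), H \is unitarymx & usubmx H = V.
Proof.
move=> VU; have [H HU e] := unitary_reduce_row V.
set L := lsubmx (V *m H^t*).
have VE : V = row_mx L 0 *m H.
  by rewrite -e hsubmxK mulmxKtV.
have LU : L \is unitarymx.
  apply/unitarymxP; move/unitarymxP: VU.
  rewrite VE trmxC_mul mulmxA mulmxtVK // tr_row_mx map_col_mx mul_row_col.
  by rewrite mul0mx addr0.
exists (block_mx L 0 0 1%:M *m H).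
  by rewrite mul_unitarymx // unitarymx_block_diag LU unitarymx1.
by rewrite block_mxEv mul_col_mx col_mxKu.
Qed.

Lemma unitary_complete_col p q (V : 'M[C]_(p + q, p)) : V^t* *m V = 1%:M ->
  exists2 H : 'M_(p + q), H \is unitarymx & lsubmx H = V.
Proof.
move=> VU.
have [|H HU HE] := @unitary_complete_row p q (V^t*).
  by apply/unitarymxP; rewrite trmxCK.
exists (H^t*); rewrite ?trmxC_unitary //.
by rewrite -[H]vsubmxK HE tr_col_mx map_row_mx trmxCK row_mxKl.
Qed.

(** * Flags and simultaneous triangularization *)

Lemma trig_tr_block (k : nat) (a : 'M[C]_1) (b : 'rV_k) (c : 'cV_k) (d : 'M_k) :
  is_trig_mx (block_mx a b c d)^T = (c == 0) && is_trig_mx d^T.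
Proof.
by rewrite tr_block_mx is_trig_block_mx // trmx_eq0 mx11_is_trig.
Qed.

Lemma exists_vector_ker m n (A : 'M[C]_(m, n)) : (\rank A < n)%N ->
  exists2 v : 'cV_n, v != 0 & A *m v = 0.
Proof.
move=> rA; have : kermx A^T != 0 by rewrite -mxrank_eq0 mxrank_ker mxrank_tr -lt0n subn_gt0.
case/rowV0Pn => v /sub_kermxP vA v0; exists v^T; first by rewrite trmx_eq0.
by rewrite -[A]trmxK -trmx_mul vA trmx0.
Qed.

(** [H] sends v to a nonzero multiple of e_1, so the first column of A H^* is a multiple of A v. *)
Lemma unitary_to_e1 k (v : 'cV[C]_(1 + k)) : v != 0 ->
  exists2 H : 'M_(1 + k), H \is unitarymx &
    dsubmx (H *m v) = 0 /\
    forall A : 'M[C]_(1 + k), dsubmx (A *m v) = 0 -> dlsubmx (A *m H^t*) = 0.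
Proof.
move=> v0; have [H HU e] := unitary_reduce_col v; exists H => //; split=> // A.
set c := usubmx (H *m v) 0 0.
have vE : v = H^t* *m col_mx c%:M 0.
  by rewrite -mx11_scalar -e vsubmxK mulmxA mulmxVt ?mul1mx.
have c0 : c != 0.
  by apply: contraNneq v0 => c0; rewrite vE c0 -scalemx1 scale0r col_mx0 mulmx0.
rewrite vE mulmxA -[A *m _]submxK mul_block_col col_mxKd block_mxKdl mulmx0 addr0.
by rewrite mul_mx_scalar => /eqP; rewrite scaler_eq0 (negPf c0) => /eqP.
Qed.

Lemma tr_trig_mx0 (A : 'M[C]_0) : is_trig_mx A^T.
Proof. by apply/is_trig_mxP => -[]. Qed.

Lemma block_mx_dl0 k (A : 'M[C]_(1 + k)) : dlsubmx A = 0 ->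
  A = block_mx (ulsubmx A) (ursubmx A) 0 (drsubmx A).
Proof. by move=> {1}<-; rewrite submxK. Qed.

Lemma interpolate_vector k (A B : 'M[C]_(1 + k)) : dlsubmx (B *m A) = 0 ->
  exists2 w : 'cV_(1 + k), w != 0 &
    dsubmx (B *m w) = 0 /\ exists c : C, lsubmx A = c *: w.
Proof.
move=> BA0; have [A0|A0] := eqVneq (lsubmx A) 0.
  (* With k rows and k + 1 columns, [dsubmx B] has a nonzero kernel vector. *)
  have [|w w0 Bw] := @exists_vector_ker _ _ (dsubmx B); first exact: rank_leq_row.
  exists w => //; split; first by rewrite -[B]vsubmxK mul_col_mx col_mxKd.
  by exists 0; rewrite scale0r.
exists (lsubmx A) => //; split; last by exists 1; rewrite scale1r.
rewrite -BA0 -[B in RHS]vsubmxK -[A in RHS]hsubmxK mul_col_row block_mxKdl.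
by rewrite -[B in LHS]vsubmxK mul_col_mx col_mxKd.
Qed.

(* The flags fixed by two matrices with an upper triangular product can be
   interpolated by a flag in the middle space: its line is spanned by the first
   column of A, or, if that is zero, by any vector that B maps into the first
   line. *)
Lemma interpolate_triangular k (A B : 'M[C]_k) : is_trig_mx (B *m A)^T ->
  exists2 S : 'M_k, S \is unitarymx &
    is_trig_mx (S *m A)^T /\ is_trig_mx (B *m S^t*)^T.
Proof.
elim: k A B => [|k IHk].
  by move=> A B _; exists 1%:M; rewrite ?unitarymx1 ?tr_trig_mx0.
rewrite -[k.+1]add1n => A B.
rewrite -[B *m A]submxK trig_tr_block => /andP[/eqP BA0 BAt].
have [w w0 [Bw [c Aw]]] := interpolate_vector BA0.
have [H HU [Hw /(_ B Bw) BH]] := unitary_to_e1 w0.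
have HA : dlsubmx (H *m A) = 0.
  rewrite -[H]vsubmxK -[A]hsubmxK mul_col_row block_mxKdl Aw -scalemxAr.
  by rewrite -[H in H *m w]vsubmxK mul_col_mx col_mxKd in Hw; rewrite Hw scaler0.
have BAE : B *m A = (B *m H^t*) *m (H *m A).
  by rewrite -mulmxA [H^t* *m _]mulmxA mulmxVt ?mul1mx.
move: (block_mx_dl0 HA) (block_mx_dl0 BH) => HAE BHE.
move: BAt; rewrite BAE HAE BHE mulmx_block block_mxKdr mul0mx add0r.
case/IHk => S SU [SA BS].
exists (block_mx 1%:M 0 0 S *m H).
  by rewrite mul_unitarymx // unitarymx_block_diag unitarymx1.
rewrite -mulmxA HAE trmxC_mul mulmxA BHE trmxC_block !trmxC0 !mulmx_block.
by rewrite !trig_tr_block !(mulmx0, mul0mx) !add0r SA BS !eqxx.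
Qed.

(** For invertible A, w is an eigenvector of B A^{-1} and v = A^{-1} w. Otherwise v lies in the
    kernel of A and w = B v, or w = v when B v = 0. *)
Lemma pencil_vector k (A B : 'M[C]_(1 + k)) :
  exists v w : 'cV_(1 + k), [/\ v != 0, w != 0,
    exists a : C, A *m v = a *: w & exists b : C, B *m v = b *: w].
Proof.
have [Au|nAu] := boolP (A \in unitmx).
  have [a /eigenvalueP[u ue u0]] := eigenvalue_closed (B *m invmx A)^T (ltn0Sn k).
  have ue' : B *m (invmx A *m u^T) = a *: u^T.
    by rewrite mulmxA -[_ *m invmx A]trmxK -trmx_mul ue linearZ.
  exists (invmx A *m u^T), u^T; split; last by exists a.
  - apply: contraNneq u0 => /(congr1 (mulmx A)).
    by rewrite mulmx0 mulKVmx // => /eqP; rewrite trmx_eq0.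
  - by rewrite trmx_eq0.
  - by exists 1; rewrite mulKVmx // scale1r.
have [|v v0 Av] := @exists_vector_ker _ _ A.
  by move: nAu; rewrite -row_free_unit -row_leq_rank -ltnNge.
have [Bv|Bv] := eqVneq (B *m v) 0.
  by exists v, v; split=> //; exists 0; rewrite scale0r.
exists v, (B *m v); split=> //; first by exists 0; rewrite scale0r.
by exists 1; rewrite scale1r.
Qed.

(* The generalized Schur (QZ) decomposition. *)
Lemma simultaneous_triangular k (A B : 'M[C]_k) :
  exists S T : 'M_k, [/\ S \is unitarymx, T \is unitarymx,
    is_trig_mx (S *m A *m T^t*)^T & is_trig_mx (S *m B *m T^t*)^T].
Proof.
elim: k A B => [|k IHk].
  by move=> A B; exists 1%:M, 1%:M; rewrite !unitarymx1 !tr_trig_mx0.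
rewrite -[k.+1]add1n => A B.
have [v [w [v0 w0 [a Av] [b Bv]]]] := pencil_vector A B.
have [H HU [Hw _]] := unitary_to_e1 w0.
have [K KU [_ Kv]] := unitary_to_e1 v0.
(* A and B map v into the line of w; [K] and [H] move the lines of v and w to that of e_1. *)
have red (M : 'M_(1 + k)) c : M *m v = c *: w -> dlsubmx (H *m M *m K^t*) = 0.
  by move=> Mv; apply: Kv; rewrite -mulmxA Mv -scalemxAr !linearZ /= Hw scaler0.
move: (block_mx_dl0 (red _ _ Av)) (block_mx_dl0 (red _ _ Bv)).
set A1 := drsubmx (_ *m A *m _); set B1 := drsubmx (_ *m B *m _) => AE BE.
have [S [T [SU TU SA SB]]] := IHk A1 B1.
exists (block_mx 1%:M 0 0 S *m H), (block_mx 1%:M 0 0 T *m K).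
have reassoc (P Q M : 'M[C]_(1 + k)) :
    P *m H *m M *m (Q *m K)^t* = P *m (H *m M *m K^t*) *m Q^t*.
  by rewrite trmxC_mul !mulmxA.
rewrite !mul_unitarymx ?unitarymx_block_diag ?unitarymx1 // !reassoc AE BE.
rewrite trmxC_block !trmxC0 !mulmx_block !trig_tr_block.
by rewrite !(mulmx0, mul0mx) !addr0 !add0r !mul0mx SA SB !eqxx.
Qed.

End Triangularization.

(** * Block unitary transformations and their products *)

Section BlockUnitary.

Variables (C : numClosedFieldType) (k : nat).

Definition dsum1 m (A : 'M[C]_m) : 'M_(k + m) := block_mx 1%:M 0 0 A.

(** The sizes are variables so that the cast along [e] can be destructed; what remains is
    associativity of blocks. *)
Lemma castmx_dsum (a a' b b' m n : nat) (A : 'M[C]_m)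
    (e : (a + (m + b) = n)%N) (e' : (a' + (m + b') = k + n)%N) :
  a' = (k + a)%N -> b' = b ->
  castmx (e', e') (block_mx 1%:M 0 0 (block_mx A 0 0 1%:M)) =
  dsum1 (castmx (e, e) (block_mx 1%:M 0 0 (block_mx A 0 0 1%:M))).
Proof.
move=> a'E bE; move: e'; rewrite a'E {}bE {a' a'E b'}; case: n / e => e'.
rewrite castmx_id; set M := block_mx A 0 0 1%:M.
rewrite /dsum1 -(row_mx0 _ k a (m + b)) -(col_mx0 _ a (m + b) k) block_mxA.
rewrite (scalar_mx_block k a) row_mx0 col_mx0.
by congr (castmx (_, _)); apply: eq_irrelevance.
Qed.

Lemma block_unitaryS l j (hj : (0 < j < l)%N) (hj' : (0 < j.+1 < l.+1)%N)
    (A : 'M[C]_(k + k)) :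
  block_unitary hj' A = dsum1 (block_unitary hj A).
Proof.
case/andP: (hj) => j_gt0 ltjl; apply: castmx_dsum; first by rewrite -mulSn; congr muln; lia.
by congr muln; lia.
Qed.

(* The matrix with active block [X Z; R V] followed by an identity, split along
   k + (k + m), which is how l.+2 * k unfolds. *)
Definition active1 m (X Z R V : 'M[C]_k) : 'M_(k + (k + m)) :=
  block_mx X (row_mx Z 0) (col_mx R 0) (block_mx V 0 0 1%:M).

Lemma block_unitary1 l (h : (0 < 1 < l.+2)%N) (X Z R V : 'M[C]_k) :
  block_unitary h (block_mx X Z R V) = active1 (l * k) X Z R V.
Proof.
have cast0 a b b' m n (A : 'M[C]_m) (e : (a + (m + b') = n)%N) (e' : (m + b = n)%N) :
    a = 0%N -> b' = b ->
    castmx (e, e) (block_mx 1%:M 0 0 (block_mx A 0 0 1%:M)) =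
    castmx (e', e') (block_mx A 0 0 1%:M).
  move=> a0 bE; move: e; rewrite a0 {}bE; case: n / e' => e; rewrite !castmx_id.
  set M := block_mx A 0 0 _; apply/matrixP => i j.
  rewrite [LHS]mxE; case: splitP => [[]|i' iE] //.
  rewrite mxE; case: splitP => [[]|j' jE] //.
  by congr (M _ _); apply: val_inj.
have bE : ((l.+2 - 1 - 1) * k = l * k)%N by congr muln; lia.
rewrite /active1 block_mxA row_mx0 col_mx0.
apply: etrans (cast0 _ _ _ _ _ _ _ (esym (addnA k k (l * k))) erefl bE) _.
by congr (castmx (_, _)); apply: eq_irrelevance.
Qed.

Lemma dsum1M m (A B : 'M[C]_m) : dsum1 (A *m B) = dsum1 A *m dsum1 B.
Proof. by rewrite mulmx_block !(mulmx0, mul0mx, mulmx1, addr0, add0r). Qed.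

Lemma dsum1_1 m : dsum1 (1%:M : 'M[C]_m) = 1%:M.
Proof. by rewrite /dsum1 -scalar_mx_block. Qed.

Lemma dsum1_trmxC m (A : 'M[C]_m) : (dsum1 A)^t* = dsum1 (A^t*).
Proof. by rewrite trmxC_block trmxC1 !trmxC0. Qed.

Lemma dsum1_prod m (s : seq nat) (P : pred nat) (F : nat -> 'M[C]_m) :
  dsum1 (\prod_(i <- s | P i) F i) = \prod_(i <- s | P i) (dsum1 (F i)).
Proof. by apply: big_morph; [exact: dsum1M | exact: dsum1_1]. Qed.

Lemma active1_dsum1C m (X Z R V : 'M[C]_k) (B : 'M_m) :
  active1 m X Z R V *m dsum1 (dsum1 B) = dsum1 (dsum1 B) *m active1 m X Z R V.
Proof.
rewrite /active1 /dsum1 !mulmx_block !mul_row_block !mul_block_col.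
by rewrite !(mulmx0, mul0mx, mulmx1, mul1mx, addr0, add0r).
Qed.

Lemma block_unitary_trmxC l j (hj : (0 < j < l)%N) (A : 'M[C]_(k + k)) :
  (block_unitary hj A)^t* = block_unitary hj (A^t*).
Proof.
by rewrite /block_unitary trmx_cast map_castmx /= !trmxC_block !trmxC1 !trmxC0.
Qed.

Lemma block_unitaryC l i j (hi : (0 < i < l)%N) (hj : (0 < j < l)%N)
    (A B : 'M[C]_(k + k)) : (i.+1 < j)%N ->
  block_unitary hi A *m block_unitary hj B = block_unitary hj B *m block_unitary hi A.
Proof.
elim: l i j hi hj => [[|i] j|l IHl [|i] [|j]] hi hj ltij; try by [].
rewrite ltnS in ltij.
have hj' : (0 < j < l)%N by lia.
rewrite (block_unitaryS hj').
(* If the first factor is at position 1, the second is the identity on the first two blocks;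
   otherwise both lose their first block. *)
have [i0|i_gt0] := posnP i.
  move: hi ltij; rewrite {}i0 => hi ltij.
  case: l j hj hj' ltij hi {IHl} => [|l] [|j] // hj hj' ltij hi.
  have hj2 : (0 < j < l)%N by lia.
  rewrite (block_unitaryS hj2) -[A]submxK block_unitary1.
  exact: active1_dsum1C.
have hi' : (0 < i < l)%N by lia.
by rewrite (block_unitaryS hi') -!dsum1M (IHl _ _ hi' hj').
Qed.

(** The adjoint reverses the product, and commutation of the factors restores the order. *)
Lemma trmxC_prod_comm m (s : seq nat) (P : pred nat) (F : nat -> 'M[C]_m) :
  {in s &, forall i j, P i -> P j -> GRing.comm (F i) (F j)} ->
  (\prod_(i <- s | P i) F i)^t* = \prod_(i <- s | P i) (F i)^t*.
Proof.
elim: s => [|a s IHs] sC; first by rewrite !big_nil trmxC1.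
have {}IHs := IHs _; rewrite !big_cons; case: ifP => Pa; last first.
  by apply: IHs => i j si sj; apply: sC; rewrite inE ?si ?sj orbT.
rewrite -IHs => [|i j si sj]; last by apply: sC; rewrite inE ?si ?sj orbT.
have cP : GRing.comm (F a) (\prod_(i <- s | P i) F i).
  rewrite big_seq_cond; apply: commr_prod => i /andP[si Pi].
  by apply: sC; rewrite ?mem_head // inE si orbT.
by rewrite cP -[_ * F a]/(_ *m F a) trmxC_mul.
Qed.

(** * Recursive construction of the factorization *)

Definition cmv_factored l (A : 'M[C]_(l * k)) : Prop :=
  exists F : nat -> 'M[C]_(l * k),
    (forall (j : nat) (hj : (0 < j < l)%N),
       exists2 Ah : 'M[C]_(k + k), cmv_active Ah & F j = block_unitary hj Ah) /\
    A = (\prod_(1 <= j < l | odd j) F j) *m (\prod_(1 <= j < l | ~~ odd j) F j).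

Lemma cmv_active_trmxC (A : 'M[C]_(k + k)) : cmv_active A -> cmv_active (A^t*).
Proof.
case/and3P=> AU ur dl; rewrite /cmv_active trmxC_unitary AU /=.
rewrite -[A]submxK trmxC_block block_mxKur block_mxKdl trmxC_trig dl.
by rewrite trmxC_tr.
Qed.

(** The adjoint swaps the odd and even products of [B], whose factors commute within each parity,
    and [dsum1] shifts positions by one. So the even factors of [B] join the new factor at position
    1 in the odd product, and the odd ones form the even product. *)
Lemma cmv_factored_step l (X Z R V : 'M[C]_k) (B : 'M_(l.+1 * k)) :
  cmv_active (block_mx X Z R V) -> cmv_factored B ->
  cmv_factored (active1 (l * k) X Z R V *m dsum1 (B^t*) : 'M_(l.+2 * k)).
Proof.
move=> Aact [F [FE ->]].
pose G j : 'M[C]_(l.+2 * k) :=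
  if j == 1%N then active1 (l * k) X Z R V else dsum1 ((F j.-1)^t*).
exists G; split.
  case=> [|[|j]] // hj.
    by exists (block_mx X Z R V); rewrite // block_unitary1.
  have hj' : (0 < j.+1 < l.+1)%N by [].
  have [Ah Aact' FjE] := FE j.+1 hj'; exists (Ah^t*); first exact: cmv_active_trmxC.
  by rewrite (block_unitaryS hj') -block_unitary_trmxC -FjE.
have prodC (P : pred nat) : (forall i j, P i -> P j -> (i < j)%N -> (i.+1 < j)%N) ->
    (\prod_(1 <= j < l.+1 | P j) F j)^t* = \prod_(1 <= j < l.+1 | P j) (F j)^t*.
  move=> Pgap; apply: trmxC_prod_comm => i j.
  rewrite !mem_index_iota => hi hj Pi Pj.
  have [Ah _ FiE] := FE i hi; have [Bh _ FjE] := FE j hj.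
  have [ltij|ltji|->] := ltngtP i j; last by [].
    by rewrite FiE FjE; apply: block_unitaryC; apply: Pgap.
  by apply: commr_sym; rewrite FiE FjE; apply: block_unitaryC; apply: Pgap.
have shift (P : pred nat) : \prod_(2 <= j < l.+2 | P j) G j =
    dsum1 (\prod_(1 <= j < l.+1 | P j.+1) (F j)^t*).
  rewrite big_add1 dsum1_prod big_nat_cond [RHS]big_nat_cond.
  by apply: eq_bigr => -[|j].
have headO : \prod_(1 <= j < l.+2 | odd j) G j = active1 (l * k) X Z R V *m
    dsum1 (\prod_(1 <= j < l.+1 | ~~ odd j) (F j)^t*).
  by rewrite big_ltn_cond // shift.
have headE : \prod_(1 <= j < l.+2 | ~~ odd j) G j =
    dsum1 (\prod_(1 <= j < l.+1 | odd j) (F j)^t*).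
  rewrite big_ltn_cond // shift.
  by congr dsum1; apply: eq_bigl => i; rewrite /= negbK.
by rewrite headO headE trmxC_mul dsum1M mulmxA !prodC // => i j; lia.
Qed.

Lemma active1_unitary m (X Z R V : 'M[C]_k) :
  block_mx X Z R V \is unitarymx -> active1 m X Z R V \is unitarymx.
Proof.
move=> HU; rewrite /active1 block_mxA row_mx0 col_mx0.
case: _ / (esym (addnA k k m)) => /=.
by rewrite castmx_id unitarymx_block_diag HU unitarymx1.
Qed.

Lemma unitary_fix_first_block m (M : 'M[C]_(k + m)) : M \is unitarymx ->
  M *m col_mx 1%:M 0 = col_mx 1%:M 0 -> exists2 B, B \is unitarymx & M = dsum1 B.
Proof.
move=> MU; rewrite -[M in M *m _]submxK mul_block_col !mulmx1 !mulmx0 !addr0.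
case/eq_col_mx => ul1 dl0.
have ME : M = block_mx 1%:M (ursubmx M) 0 (drsubmx M) by rewrite -ul1 -dl0 submxK.
have ur0 : ursubmx M = 0.
  move: (mulmxVt MU); rewrite ME trmxC_block mulmx_block (scalar_mx_block k m).
  by case/eq_block_mx => _; rewrite trmxC1 trmxC0 mul1mx mul0mx addr0 -ME.
exists (drsubmx M); last by rewrite {1}ME ur0.
by move: MU; rewrite {1}ME ur0 unitarymx_block_diag => /andP[].
Qed.

(** [W] compresses the first block column to its top blocks X and R, an isometric column that
    completes to a unitary 2k x 2k matrix. Removing this factor leaves a unitary matrix that fixes
    the first k unit vectors. *)
Lemma factor_active1 m (A : 'M[C]_(k + (k + m))) : A \is unitarymx ->
  exists (W B : 'M_(k + m)) (X Z R V : 'M_k),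
    [/\ W \is unitarymx, B \is unitarymx, block_mx X Z R V \is unitarymx &
        dsum1 W *m A *m (dsum1 W)^t* = active1 m X Z R V *m dsum1 B].
Proof.
move=> AU; have [W WU W0] := unitary_reduce_col (dlsubmx A).
pose A2 := dsum1 W *m A *m (dsum1 W)^t*.
have A2U : A2 \is unitarymx.
  by rewrite !mul_unitarymx ?trmxC_unitary // unitarymx_block_diag unitarymx1.
set X := ulsubmx A; set R := usubmx (W *m dlsubmx A).
have A2E : A2 *m col_mx 1%:M 0 = col_mx X (col_mx R 0).
  rewrite -W0 vsubmxK /A2 -mulmxA dsum1_trmxC [dsum1 (W^t*) *m _]mul_block_col.
  rewrite !(mul0mx, mulmx0, mulmx1, addr0) -[A in _ *m A *m _]submxK mulmx_block.
  by rewrite mul_block_col !(mul0mx, mulmx0, mulmx1, mul1mx, add0r, addr0).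
have [|H HU HE] := @unitary_complete_col C k k (col_mx X R).
  have := congr1 (fun M => M^t* *m M) A2E.
  rewrite /= trmxC_mul -mulmxA [A2^t* *m _]mulmxA (mulmxVt A2U) mul1mx.
  rewrite !tr_col_mx !map_row_mx !mul_row_col !trmxC0 !mul0mx !addr0 trmxC1 mul1mx.
  by move=> ->.
set Z := usubmx (rsubmx H); set V := dsubmx (rsubmx H).
have HB : H = block_mx X Z R V by rewrite block_mxEh vsubmxK -HE hsubmxK.
rewrite HB in HU; have GU := active1_unitary m HU; set G := active1 _ _ _ _ _ in GU.
have [||B BU BE] := @unitary_fix_first_block _ (G^t* *m A2).
- by rewrite mul_unitarymx ?trmxC_unitary.
- have -> : G^t* *m A2 *m col_mx 1%:M 0 = G^t* *m (G *m col_mx 1%:M 0).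
    by rewrite -mulmxA A2E mul_block_col !mulmx1 !mulmx0 !addr0.
  by rewrite mulmxA mulmxVt ?mul1mx.
by exists W, B, X, Z, R, V; rewrite -BE mulmxA mulmxtV // mul1mx.
Qed.

(** * Changes of basis that triangularize the corner blocks *)

Lemma active1_gauge m (X Z R V S T S' T' : 'M[C]_k) (P : 'M_m) : P \is unitarymx ->
  block_mx S 0 0 (block_mx S' 0 0 P) *m active1 m X Z R V *m
    (block_mx T 0 0 (block_mx T' 0 0 P))^t* =
  active1 m (S *m X *m T^t*) (S *m Z *m T'^t*) (S' *m R *m T^t*) (S' *m V *m T'^t*).
Proof.
move=> PU; rewrite /active1 !trmxC_block !trmxC0 !mulmx_block.
rewrite !(mulmx0, mul0mx, addr0, add0r) !mul_mx_row !mul_col_mx.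
rewrite !mul_row_block !mul_row_col mulmx1 (mulmxtV PU).
by rewrite !(mulmx0, mul0mx, addr0, add0r).
Qed.

(* S and T are the bases of the first block outside and between the two products.
   M and N stand for the parts of the two chains that precede this block, S0 for
   the basis of the space where both of them start. *)
Definition reducible l (A : 'M[C]_(l.+1 * k)) : Prop :=
  forall M N : 'M[C]_k, exists (S0 S T : 'M_k) (P : 'M_(l * k)),
    [/\ [&& S0 \is unitarymx, S \is unitarymx, T \is unitarymx & P \is unitarymx],
        is_trig_mx (S *m M *m S0^t*)^T, is_trig_mx (T *m N *m S0^t*)^T &
        cmv_factored (block_mx S 0 0 P *m (A : 'M_(k + l * k)) *m
                      (block_mx T 0 0 P)^t* : 'M_(l.+1 * k))].

(* The bases S and T of the first block are still free here: they are interpolated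
   in the induction step, but must both be S0 at the start of the chains. *)
Lemma reducible_chain l (A : 'M[C]_(l.+2 * k)) :
  (forall B : 'M_(l.+1 * k), B \is unitarymx -> reducible B) ->
  A \is unitarymx ->
  exists R Z : 'M_k, forall M N : 'M_k, exists (S0 S' T' : 'M_k) (P : 'M_(l.+1 * k)),
    [/\ [&& S0 \is unitarymx, S' \is unitarymx, T' \is unitarymx & P \is unitarymx],
        is_trig_mx (S' *m (R *m N) *m S0^t*)^T,
        is_trig_mx (T' *m (Z *m M) *m S0^t*)^T &
        forall S T : 'M_k, S \is unitarymx -> T \is unitarymx ->
          is_trig_mx (S' *m R *m T^t*)^T -> is_trig_mx (T' *m Z *m S^t*)^T ->
          cmv_factored (block_mx S 0 0 P *m (A : 'M_(k + l.+1 * k)) *m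
                        (block_mx T 0 0 P)^t* : 'M_(l.+2 * k))].
Proof.
move=> IH AU.
have [W [B [X [Z [R [V [WU BU HU AE]]]]]]] := @factor_active1 (l * k) A AU.
exists R, (Z^t*) => M N.
(* [cmv_factored_step] takes the adjoint of the remainder, hence [B^t*]; the two chains exchange
   roles accordingly. *)
have [|S0 [S' [T' [P' [/and4P[S0U S'U T'U PU] trM trN cmvB]]]]] :=
  IH (B^t*) _ (R *m N) (Z^t* *m M); first by rewrite trmxC_unitary.
pose P := block_mx S' 0 0 P' *m W.
have diagU (Q : 'M_k) : Q \is unitarymx -> block_mx Q 0 0 P' \is unitarymx.
  by move=> QU; rewrite unitarymx_block_diag QU.
exists S0, S', T', P; split=> //.
  by rewrite S0U S'U T'U mul_unitarymx ?diagU.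
move=> S T SU TU trR trZ.
have PE (Q : 'M_k) : block_mx Q 0 0 P = block_mx Q 0 0 (block_mx S' 0 0 P') *m dsum1 W.
  by rewrite mulmx_block !(mulmx0, mul0mx, mulmx1, addr0, add0r).
(* [D] is the basis change between the first factor and the rest. Its tail P' is that of the left
   side, as [active1_gauge] requires; its first block T is that of the right side, since [dsum1 B]
   is the identity there. *)
pose D := block_mx T 0 0 (block_mx T' 0 0 P').
have DU : D \is unitarymx by rewrite /D unitarymx_block_diag TU diagU.
have -> : block_mx S 0 0 P *m A *m (block_mx T 0 0 P)^t* =
    (block_mx S 0 0 (block_mx S' 0 0 P') *m active1 (l * k) X Z R V *m D^t*) *m
    dsum1 ((block_mx S' 0 0 P' *m B^t* *m (block_mx T' 0 0 P')^t*)^t*).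
  have -> : dsum1 ((block_mx S' 0 0 P' *m B^t* *m (block_mx T' 0 0 P')^t*)^t*) =
      D *m dsum1 B *m (block_mx T 0 0 (block_mx S' 0 0 P'))^t*.
    rewrite !trmxC_mul !trmxCK mulmxA /D /dsum1 !trmxC_block !trmxC0 !mulmx_block.
    by rewrite !(mulmx0, mul0mx, mulmx1, addr0, add0r) mulmxtV.
  rewrite !PE trmxC_mul -!mulmxA [D^t* *m _]mulmxA mulmxVt // mul1mx.
  by rewrite [active1 _ _ _ _ _ *m _]mulmxA -AE !mulmxA.
rewrite active1_gauge //; apply: cmv_factored_step => //.
rewrite /cmv_active block_mxKur block_mxKdl trR -[X in is_trig_mx X && _]trmxCK.
rewrite trmxC_trig !trmxC_mul trmxCK mulmxA trZ !andbT.
have -> : block_mx (S *m X *m T^t*) (S *m Z *m T'^t*) (S' *m R *m T^t*) (S' *m V *m T'^t*)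
    = block_mx S 0 0 S' *m block_mx X Z R V *m (block_mx T 0 0 T')^t*.
  by rewrite trmxC_block !trmxC0 !mulmx_block !(mulmx0, mul0mx, addr0, add0r).
by rewrite !mul_unitarymx ?trmxC_unitary // unitarymx_block_diag ?SU ?TU.
Qed.

Lemma reducible1 (A : 'M[C]_(1 * k)) : A \is unitarymx -> reducible A.
Proof.
move=> AU M N; pose a : 'M_k := ulsubmx (A : 'M_(k + 0 * k)).
have AE : (A : 'M_(k + 0 * k)) = block_mx a 0 0 1%:M.
  rewrite -[LHS]submxK (thinmx0 (ursubmx _)) (flatmx0 (dlsubmx _)).
  by rewrite (flatmx0 (drsubmx _)) (flatmx0 1%:M).
have aU : a \is unitarymx by move: AU; rewrite AE unitarymx_block_diag => /andP[].
(* The empty factorization forces S a T^* = 1, so T = S a, and both conditions involve only S and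
   S0. *)
have [S [S0 [SU S0U trM trN]]] := simultaneous_triangular M (a *m N).
have SaU : S *m a \is unitarymx by rewrite mul_unitarymx.
exists S0, S, (S *m a), 1%:M; split=> //; first by rewrite S0U SU SaU unitarymx1.
  by rewrite -[S *m a *m N]mulmxA.
exists (fun=> 1%:M); split; first by move=> j hj; exfalso; lia.
rewrite !big_geq // AE trmxC_block !trmxC0 !mulmx_block.
rewrite !(mulmx0, mul0mx, addr0, add0r) mulmxtV // trmxC1 !mulmx1.
by rewrite -scalar_mx_block.
Qed.

Lemma unitarymx_reducible l (A : 'M[C]_(l.+1 * k)) : A \is unitarymx -> reducible A.
Proof.
elim: l A => [|l IHl] A AU; first exact: reducible1.
move=> M N; have [R [Z /(_ M N)]] := reducible_chain IHl AU.
case=> [S0 [S' [T' [P [/and4P[S0U S'U T'U PU] trR trZ cmvP]]]]].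
have [|T TU [trN trR']] := @interpolate_triangular C k (N *m S0^t*) (S' *m R).
  by rewrite !mulmxA in trR *.
have [|S SU [trM trZ']] := @interpolate_triangular C k (M *m S0^t*) (T' *m Z).
  by rewrite !mulmxA in trZ *.
exists S0, S, T, P; split; first by rewrite S0U SU TU.
- by rewrite -mulmxA.
- by rewrite -mulmxA.
- exact: cmvP.
Qed.

Theorem unitary_cmv_reduction l (A : 'M[C]_(l.+2 * k)) (U : 'M_(l.+2 * k, k)) :
  A \is unitarymx ->
  exists (P : 'M[C]_(l.+2 * k)) (U1 : 'M[C]_k),
    [/\ P \is unitarymx, cmv_structured (P *m A *m P^t*) &
        P *m U = e1_tens_id C l.+2 k *m U1].
Proof.
move=> AU; have [Q QU QU0] := @unitary_reduce_col C k (l.+1 * k) U.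
have A'U : Q *m A *m Q^t* \is unitarymx by rewrite !mul_unitarymx ?trmxC_unitary.
(* M = N = 1 starts both chains at the first block, and S = T = S0 turns the change of bases into a
   conjugation. *)
have [R [Z /(_ 1%:M 1%:M)]] := reducible_chain (@unitarymx_reducible l) A'U.
rewrite !mulmx1.
case=> [S0 [S' [T' [P [/and4P[S0U S'U T'U PU] trR trZ /(_ S0 S0 S0U S0U trR trZ)]]]]].
move=> [F [FE AE]].
(* The block diagonal factor keeps the columns of Q U within the first k coordinates. *)
exists (block_mx S0 0 0 P *m Q), (S0 *m usubmx (Q *m U)).
have DU : block_mx S0 0 0 P \is unitarymx by rewrite unitarymx_block_diag S0U.
have PU' : block_mx S0 0 0 P *m Q \is unitarymx by rewrite mul_unitarymx.
split=> //.
  split; first by rewrite !mul_unitarymx ?trmxC_unitary.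
  by exists F; split=> //; rewrite -AE trmxC_mul !mulmxA.
rewrite e1_tens_idE -mulmxA -[Q *m U]vsubmxK QU0 mul_block_col !mulmx0 mul0mx !addr0.
by rewrite col_mxKu (pid_mx_col _ (l.+1 * k) k) mul_col_mx mul1mx mul0mx.
Qed.

End BlockUnitary.

Theorem theorem3p17 (R : realType) (l k : nat) (hl : (2 <= l)%N)
    (D : 'M[R[i]]_(l * k)) (U : 'M[R[i]]_(l * k, k))
    (D_unitary : D \is unitarymx) (D_diag : is_diag_mx D) :
  exists (P : 'M[R[i]]_(l * k)) (U1 : 'M[R[i]]_k),
    [/\ P \is unitarymx,
        cmv_structured (P *m D *m P ^t*) &
        P *m U = e1_tens_id R[i] l k *m U1].
Proof.
case: l hl D U D_unitary D_diag => [|[|l]] // _ D U D_unitary _.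
exact: unitary_cmv_reduction.
Qed.
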